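(* Let $h\ge 1$, $H=\{0,\dots,h-1\}$, let $p^t>0$ ($t\in H$) be deterministic, and let $(\gamma^i,\underline{x}^i,\overline{x}^i)_{i\ge1}$ be an i.i.d. sequence of random vectors on a probability space $(\Omega,\mathcal F,\mathbb P)$ with $\gamma^1$ a positive random variable, $\underline{x}^1,\overline{x}^1$ non-negative random vectors in $\mathbb{R}^{h}$, $\mathbb{E}[\gamma^1]<\infty$ and $\mathbb{E}[(\gamma^1)^2]<\infty$. Assume that the constraint sets $X^i$, $i\ge 1$, are nonempty and compact. For each $m\ge1$ let $x^\star$ be any minimizer of problem $\mathcal P$ with $m$ agents and let $x_a^\star$ be any minimizer of problem $\mathcal P_a$ with $m$ agents (both problems, $X^i$ and $F^m$ are defined in the context; $x^\star,x^\star_a$ depend on $m$ and on the realization). Then $$\lim_{m\to\infty}\frac{F^m(x_a^\star)}{F^m(x^\star)}=1\qquad \mathbb{P}\text{-almost surely},$$ where $F^m(x^\star)>0$; i.e., the price of anarchy tends to $1$.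
   Context: For $m\ge1$ agents, $I=\{1,\dots,m\}$. Agent $i$ has decision vector $x^i=(x^{it})_{t\in H}\in\mathbb{R}^{h}$ and constraint set $$X^i=\Big\{x^i\in\mathbb{R}^h:\ \sum_{t\in H}x^{it}=\gamma^i,\ x^{it}\in[\underline{x}^{it},\overline{x}^{it}]\ \text{for all }t\in H\Big\},$$ where $\underline{x}^i=(\underline{x}^{it})_{t\in H}$, $\overline{x}^i=(\overline{x}^{it})_{t\in H}$. Write $x=(x^1,\dots,x^m)\in X=X^1\times\dots\times X^m$. For each $m$ there are given constants $x^{0t}=x^{0t}_m\ge0$, $t\in H$ (non-PEV demand, allowed to depend on $m$), such that $\lim_{m\to\infty}x^{0t}_m/m=\hat{x}^{0t}$ exists and is a finite constant for each $t\in H$. Define $$F^m(x)=\sum_{t\in H}p^t\Big(\sum_{i\in I}x^{it}+x^{0t}\Big)^2,\qquad F^m_a(x)=\sum_{i\in I}\sum_{t\in H}p^t(x^{it})^2 .$$ Problem $\mathcal P$ (social optimum): $\min_{x\in X}F^m(x)$. Problem $\mathcal P_a$ (auxiliary problem): $\min_{x\in X}\big[F^m(x)+F^m_a(x)\big]$. The non-cooperative game: agent $i$ minimizes over $x^i\in X^i$ the pay-off $f(x^i,x^{-i})=\sum_{t\in H}x^{it}p^t\big(\sum_{j\in I,j\ne i}x^{jt}+x^{it}+x^{0t}\big)$, where $x^{-i}$ collects the other agents' decisions. Under the present assumptions its unique Nash equilibrium is the minimizer $x_a^\star$ of $\mathcal P_a$, and the price of anarchy for $m$ agents is defined as $F^m(x_a^\star)/F^m(x^\star)$.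 *)

(* Defs.v *)
From mathcomp Require Import all_boot all_order all_algebra finmap.
From mathcomp Require Import all_classical all_reals all_analysis.

Set Implicit Arguments.
Unset Strict Implicit.
Unset Printing Implicit Defensive.

Import Order.TTheory GRing.Theory Num.Theory.
Import numFieldNormedType.Exports.

Local Open Scope classical_set_scope.
Local Open Scope ring_scope.

(* The random vector (gamma, xlow, xup) of one agent, as a point of
   R * R^h * R^h. Using a single measurable type for the triple lets
   independence and equality in law concern the joint vector, so that
   gamma, xlow and xup of the same agent may be dependent. *)
Notation agent R h := (R * h.-tuple R * h.-tuple R)%type.

Section agent_data.
Context {R : realType} {h : nat}.
Implicit Types a : agent R h.

Definition gamma a : R := a.1.1.
Definition xlow a (t : 'I_h) : R := tnth a.1.2 t.
Definition xup a (t : 'I_h) : R := tnth a.2 t.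

Definition constraint_set a : set 'rV[R]_h :=
  [set x | \sum_(t < h) x 0 t = gamma a /\
           forall t, x 0 t \in `[xlow a t, xup a t]].

(* Row i of x is the decision vector of agent i; agents are numbered from 0. *)
Definition joint_set (a : nat -> agent R h) (m : nat) : set 'M[R]_(m, h) :=
  [set x | forall i : 'I_m, constraint_set (a i) (row i x)].

End agent_data.

Arguments joint_set {R h} a m _.

Section costs.
Context {R : realType} {h : nat}.
Variables (p : 'I_h -> R) (m : nat).

Definition social_cost (x0 : 'I_h -> R) (x : 'M[R]_(m, h)) : R :=
  \sum_(t < h) p t * (\sum_(i < m) x i t + x0 t) ^+ 2.

Definition aux_cost (x : 'M[R]_(m, h)) : R :=
  \sum_(i < m) \sum_(t < h) p t * x i t ^+ 2.

End costs.

Definition minimizer (R : realType) (T : Type) (S : set T) (f : T -> R)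
    (x : T) : Prop :=
  S x /\ forall y, S y -> f x <= f y.

Section iid.
Context {d d' : measure_display} {T : measurableType d} {T' : measurableType d'}.
Context {R : realType} (P : probability T R).

Definition mutually_independent (X : nat -> {RV P >-> T'}) : Prop :=
  forall (J : {fset nat}) (A : nat -> set T'),
    (forall i, i \in J -> measurable (A i)) ->
    P (\bigcap_(i in [set` J]) (X i @^-1` A i)) =
    (\prod_(i <- J) P (X i @^-1` A i))%E.

Definition identically_distributed (X : nat -> {RV P >-> T'}) : Prop :=
  forall (i j : nat) (A : set T'), measurable A ->
    distribution P (X i) A = distribution P (X j) A.

End iid.

(* Main.v *)
Require Import Defs.
From mathcomp Require Import all_boot all_order all_algebra finmap.
From mathcomp Require Import all_classical all_reals all_analysis.
From mathcomp Require Import measurable_realfun zify ring lra.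
Import Order.TTheory GRing.Theory Num.Theory.
Import numFieldNormedType.Exports.
Local Open Scope classical_set_scope.
Local Open Scope ring_scope.

(** Write y for the social optimum and z for the auxiliary one.  Optimality
    gives F(y) <= F(z) <= F(y) + Fa(y).  Since the decisions of agent i are
    nonnegative and sum to gamma_i, Fa(y) is at most a constant times
    sum_i gamma_i^2, whereas F(y) is at least a constant times
    (sum_i gamma_i)^2; hence it is enough that
    sum_i gamma_i^2 / (sum_i gamma_i)^2 -> 0 almost surely.  This needs no
    strong law of large numbers: gamma_i / i -> 0 because
    sum_i E[gamma_i^2] / i^2 is finite, so that sum_i gamma_i^2 is o(m)
    times sum_i gamma_i; and sum_i gamma_i grows at least linearly because the
    frequency of the events {gamma_i > c} is controlled along m = k^2 by
    Chebyshev's inequality and between squares by monotonicity. *)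

(** * Almost sure convergence from summable integrals *)

(** Integrating termwise, the sum of the series has finite integral, so it is finite almost
    everywhere; the terms of a convergent series tend to 0. *)
Lemma ae_cvg0_of_summable_integral (R : realType) (d : measure_display)
    (T : measurableType d) (mu : {measure set T -> \bar R}) (f : nat -> T -> R) :
  (forall n, measurable_fun setT (f n)) -> (forall n x, 0 <= f n x) ->
  (\sum_(n <oo) \int[mu]_x (f n x)%:E < +oo)%E ->
  \forall x \ae mu, f n x @[n --> \oo] --> (0 : R).
Proof.
move=> mf f0 sumf.
have mEf n : measurable_fun setT (EFin \o f n) by exact/measurable_EFinP.
have Ef0 n x : (0 <= (f n x)%:E)%E by rewrite lee_fin.
have sumf0 x : (0 <= \sum_(n <oo) (f n x)%:E)%E.
  by apply: nneseries_ge0 => n _ _; exact: Ef0.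
have : mu.-integrable setT (fun x => \sum_(n <oo) (f n x)%:E)%E.
  apply/integrableP; split.
    by apply: ge0_emeasurable_sum => [n x _ _|n _]; [exact: Ef0|exact: mEf].
  under eq_integral do rewrite gee0_abs//.
  by rewrite integral_nneseries.
move=> /(integrable_ae measurableT); apply: filterS => x /(_ I) sumx.
have /nneseries_tail_cvg tail : (\sum_(n <oo) (f n x)%:E < +oo)%E.
  by rewrite ltey_eq sumx.
suff /fine_cvgP[//] : (f n x)%:E @[n --> \oo] --> 0%E.
(* Each term is at most the tail of the series that starts with it. *)
apply: (squeeze_cvge _ (cvg_cst 0%E) (tail _)) => //.
apply: nearW => n; rewrite Ef0/=.
have := @nneseries_lim_ge R (fun k => (f k x)%:E) xpredT n n.+1
  (fun k _ _ => Ef0 k x).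
by rewrite big_nat1.
Qed.

Lemma nneseries_inv_sqr_lty (R : realType) :
  (\sum_(n <oo) (n.+1%:R ^- 2 : R)%:E < +oo)%E.
Proof.
apply: (@le_lt_trans _ _ 2%:E); last exact: ltry.
apply: lime_le; first by apply: is_cvg_nneseries => n _ _; rewrite lee_fin.
apply: nearW => -[|n]; rewrite sumEFin lee_fin; first by rewrite big_nil.
(* The sharper bound makes the induction telescope: [1/(x+1)^2 <= 1/x - 1/(x+1)]. *)
suff : \sum_(0 <= i < n.+1) i.+1%:R ^- 2 <= 2 - n.+1%:R^-1 :> R.
  by move=> /le_trans; apply; rewrite gerBl.
elim: n => [|n IHn]; first by rewrite big_nat1 invr1; lra.
rewrite big_nat_recr//=; apply: (le_trans (lerD IHn (lexx _))).
have : 0 < n.+1%:R :> R by [].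
rewrite (natrD _ 1 n.+1); set x := n.+1%:R => x0.
rewrite -subr_ge0.
have -> : 2 - (1%:R + x)^-1 - (2 - x^-1 + (1%:R + x) ^- 2) =
    x^-1 * (1%:R + x) ^- 2 :> R by field; lra.
by rewrite mulr_ge0// invr_ge0 ?exprn_ge0; lra.
Qed.

(** * Frequency of pairwise independent events of equal probability *)

Section indicator_sum.
Context (R : realType) (d : measure_display) (T : measurableType d)
  (P : probability T R) (A : nat -> set T) (q : R).
Hypothesis mA : forall i, measurable (A i).
Hypothesis PA : forall i, P (A i) = q%:E.
Hypothesis PAA : forall i j, i != j -> P (A i `&` A j) = (q ^+ 2)%:E.

Let N n x : R := \sum_(i < n) \1_(A i) x.

Let mN n : measurable_fun setT (N n).
Proof. by apply: measurable_sum => i; exact: measurable_indic. Qed.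

Let N0 n x : 0 <= N n x. Proof. by apply: sumr_ge0. Qed.

Let integral_indicA i : (\int[P]_x (\1_(A i) x)%:E = q%:E)%E.
Proof. by rewrite integral_indic// setIT; exact: PA. Qed.

Let integral_indicAA i j : (\int[P]_x (\1_(A i `&` A j) x)%:E =
  (if i == j then q else q ^+ 2)%:E)%E.
Proof.
case: eqVneq => [->|ij]; first by rewrite setIid integral_indicA.
have mAij : measurable (A i `&` A j) by exact: measurableI.
by rewrite integral_indic// setIT; exact: PAA.
Qed.

Lemma integral_indic_sum n : (\int[P]_x (N n x)%:E = (n%:R * q)%:E)%E.
Proof.
under eq_integral do rewrite -sumEFin.
rewrite ge0_integral_sum//.
- under eq_bigr do rewrite integral_indicA.
  by rewrite sumEFin sumr_const card_ord mulr_natl.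
- by move=> i; apply/measurable_EFinP; exact: measurable_indic.
Qed.

(** The square expands over ordered pairs: the [n] diagonal ones contribute [q] each, the [n(n-1)]
    others [q^2] each. *)
Lemma integral_indic_sum_sqr n :
  (\int[P]_x (N n x ^+ 2)%:E = (n%:R * q + n%:R * (n%:R - 1) * q ^+ 2)%:E)%E.
Proof.
have -> : (fun x => (N n x ^+ 2)%:E) =
    (fun x => \sum_(ij : 'I_n * 'I_n) (\1_(A ij.1 `&` A ij.2) x)%:E)%E.
  apply/funext => x; rewrite sumEFin; congr EFin.
  rewrite expr2 /N mulr_suml; under eq_bigr do rewrite mulr_sumr.
  rewrite pair_big/=; apply: eq_bigr => -[i j] _ /=.
  by rewrite indicI.
rewrite ge0_integral_sum//; last first.
  by move=> i; apply/measurable_EFinP; apply: measurable_indic; exact: measurableI.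
under eq_bigr do rewrite integral_indicAA.
rewrite sumEFin; congr EFin.
rewrite -(pair_big xpredT xpredT
  (fun i j : 'I_n => if (i : nat) == j then q else q ^+ 2))/=.
under eq_bigr => i _.
  rewrite (bigD1 i)//= eqxx.
  under eq_bigr => j ji do rewrite eq_sym (negPf ji : (j : nat) == i = false).
  rewrite sumr_const cardC1 card_ord.
  over.
rewrite sumr_const card_ord.
(* At [n = 0] the truncated [n.-1] differs from [n%:R - 1], but both are multiplied by 0. *)
case: n => [|n]; first by rewrite mulr0n; lra.
rewrite -[_ *+ n.+1]mulr_natl -[_ *+ n.+1.-1]mulr_natl /= -[in RHS]natr1; ring.
Qed.

Lemma integral_indic_sum_dev n :
  (\int[P]_x ((N n x - n%:R * q) ^+ 2)%:E = (n%:R * (q - q ^+ 2))%:E)%E.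
Proof.
have q0 : 0 <= q by rewrite -lee_fin -(PA 0); exact: measure_ge0.
have nq0 : 0 <= 2 * (n%:R * q) by rewrite !mulr_ge0.
have mNE : measurable_fun setT (fun x => (N n x)%:E) by exact/measurable_EFinP.
have mdev : measurable_fun setT (fun x => ((N n x - n%:R * q) ^+ 2)%:E).
  by apply/measurable_EFinP; apply: measurable_funX; exact: measurable_funB.
have mN2 : measurable_fun setT (fun x => (N n x ^+ 2)%:E).
  by apply/measurable_EFinP; exact: measurable_funX.
(* The cross term is moved to the left so that all integrands are nonnegative. *)
have : (\int[P]_x ((N n x - n%:R * q) ^+ 2)%:E +
   \int[P]_x ((2 * (n%:R * q))%:E * (N n x)%:E) =
   \int[P]_x (N n x ^+ 2)%:E + \int[P]_x (((n%:R * q) ^+ 2)%:E))%E.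
  rewrite -!ge0_integralD//.
  - by apply: eq_integral => x _ ; rewrite -!EFinM -!EFinD; congr EFin; ring.
  - by move=> x _; rewrite lee_fin sqr_ge0.
  - by move=> x _; rewrite lee_fin sqr_ge0.
  - by move=> x _; rewrite lee_fin sqr_ge0.
  - by move=> x _; rewrite -EFinM lee_fin mulr_ge0.
  - exact: measurable_funeM.
rewrite ge0_integralZl_EFin//; last by move=> x _; rewrite lee_fin.
rewrite integral_indic_sum integral_indic_sum_sqr.
have -> : (\int[P]_x ((n%:R * q) ^+ 2)%:E = ((n%:R * q) ^+ 2)%:E)%E.
  transitivity (((n%:R * q) ^+ 2)%:E * P setT)%E; first exact: integral_cst.
  by rewrite probability_setT mule1.
(* The right-hand side is finite, so the unknown integral is a real number [r] and the equation can
   be solved for it. *)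
rewrite -EFinM; case: (\int[P]_x _)%E => // r [rE]; congr EFin.
by rewrite -[LHS](addrK (2 * (n%:R * q) * (n%:R * q))) rE; ring.
Qed.

(** The frequency over [n] events has variance [(q - q^2) / n <= 1 / n], which is summable along
    [u]. *)
Lemma ae_indic_sum_dev_cvg0 (u : nat -> nat) : (forall k, (0 < u k)%N) ->
  (\sum_(k <oo) ((u k)%:R^-1 : R)%:E < +oo)%E ->
  \forall x \ae P, ((u k)%:R^-1 * (N (u k) x - (u k)%:R * q)) ^+ 2
    @[k --> \oo] --> (0 : R).
Proof.
move=> u0 sumu; have mdev n : measurable_fun setT (fun x => N n x - n%:R * q).
  exact: measurable_funB.
apply: ae_cvg0_of_summable_integral => [k|k x|].
- by apply: measurable_funX; exact: measurable_funM.
- exact: sqr_ge0.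
- apply: le_lt_trans sumu.
  apply: lee_nneseries => [k _ _|k _].
    by apply: integral_ge0 => x _; rewrite lee_fin sqr_ge0.
  under eq_integral do rewrite exprMn EFinM.
  rewrite ge0_integralZl_EFin ?sqr_ge0//; last 2 first.
  + by move=> x _; rewrite lee_fin sqr_ge0.
  + apply/measurable_EFinP.
    exact: (@measurable_funX _ _ _ setT _ 2%N (mdev (u k))).
  rewrite integral_indic_sum_dev -EFinM lee_fin.
  have k0 : 0 < (u k)%:R :> R by rewrite ltr0n.
  rewrite mulrA expr2 mulfVK ?gt_eqF//.
  by rewrite ler_piMr ?invr_ge0 ?(ltW k0)//; nra.
Qed.

(** Along squares the frequency is eventually at least [q / 2]. The count is nondecreasing in [m],
    and passing from [m] down to the largest square below it loses at most a factor 4, whence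
    [q / 8]. *)
Lemma ae_indic_sum_ge : 0 < q ->
  \forall x \ae P, \forall m \near \oo, q / 8 * m%:R <= N m x.
Proof.
move=> q0; have := @ae_indic_sum_dev_cvg0 (fun k => k.+1 ^ 2)%N.
have sumu : (\sum_(k <oo) ((k.+1 ^ 2)%:R^-1 : R)%:E < +oo)%E.
  by under eq_eseriesr do rewrite natrX; exact: nneseries_inv_sqr_lty.
move=> /(_ (fun k => expn_gt0 k.+1 2) sumu).
apply: filterS => x fx.
have [K _ NK] : \forall k \near \oo, q / 2 * (k.+1 ^ 2)%:R <= N (k.+1 ^ 2) x.
  (* A frequency below [q / 2] would deviate from [q] by more than [q / 2], so this is the tolerance
     for the squared deviation. *)
  have q4 : 0 < (q / 2) ^+ 2 by rewrite exprn_gt0// divr_gt0.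
  move/cvgrPdist_lt : fx => /(_ _ q4); apply: filterS => k.
  rewrite sub0r normrN /=.
  rewrite ger0_norm ?sqr_ge0// => dev.
  have n0 : 0 < (k.+1 ^ 2)%:R :> R by rewrite ltr0n.
  move: (k.+1 ^ 2)%N n0 dev => n n0 dev.
  rewrite leNgt; apply/negP => small.
  have : n%:R^-1 * (N n x - n%:R * q) < - (q / 2).
    by rewrite ltr_pdivrMl//; lra.
  nra.
(* From [(K+2)^2 <= m < (k+2)^2] it follows that [k] lies beyond [K]. *)
exists (K.+2 ^ 2)%N => //= m Km.
have m0 : (0 < m)%N by exact: leq_trans Km.
have [k /andP[km mk]] : exists k, (k.+1 ^ 2 <= m < k.+2 ^ 2)%N.
  elim: m {Km} m0 => // -[_ _|m IHm _]; first by exists 0.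
  have [k /andP[km mk]] := IHm isT.
  have [mk'|mk'] := ltnP m.+2 (k.+2 ^ 2).
    by exists k; rewrite mk' (leq_trans km).
  by exists k.+1; rewrite mk' (leq_ltn_trans mk)// ltn_exp2r.
have Kk : (K <= k)%N.
  by have := leq_ltn_trans Km mk; rewrite ltn_exp2r//; lia.
have NkNm : N (k.+1 ^ 2) x <= N m x.
  rewrite /N -!(big_mkord xpredT (fun i => \1_(A i) x)).
  rewrite (@big_cat_nat _ _ _ _ 0%N m _ _ (leq0n _) km)/=.
  by rewrite lerDl sumr_ge0.
apply: le_trans NkNm; apply: le_trans (NK _ Kk).
(* Consecutive squares satisfy [(k+2)^2 <= 4 (k+1)^2]. *)
have : m%:R <= 4 * (k.+1 ^ 2)%:R :> R.
  rewrite -natrM ler_nat; apply: leq_trans (ltnW mk) _; lia.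
nra.
Qed.
End indicator_sum.

(** * Sum of squares against square of the sum, for a fixed sequence *)

(** The first [K] values are each at most their sum [M], which [e * m] eventually exceeds; beyond
    [K], [g i < e * (i+1) <= e * m] since [i < m]. *)
Lemma near_le_scaled_index (R : realType) (g : nat -> R) (e : R) :
  (forall i, 0 <= g i) -> g i / i.+1%:R @[i --> \oo] --> (0 : R) -> 0 < e ->
  \forall m \near \oo, forall i, (i < m)%N -> g i <= e * m%:R.
Proof.
move=> g0 /cvgrPdist_lt g_cvg e0; have [K _ gK] := g_cvg e e0.
pose M := \sum_(i < K) g i.
have : \forall m \near \oo, M / e <= m%:R by exact: nbhs_infty_ger.
apply: filterS => m; rewrite ler_pdivrMr// mulrC => Mm i im.
have [Ki|iK] := leqP K i.
  have := gK i Ki; rewrite /= sub0r normrN ger0_norm ?divr_ge0//.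
  rewrite ltr_pdivrMr// => /ltW /le_trans; apply.
  by rewrite ler_pM2l// ler_nat.
by apply: le_trans Mm; rewrite /M (bigD1 (Ordinal iK))//= lerDl sumr_ge0.
Qed.

(** Let [S] be the sum. Eventually every [g i] with [i < m] is at most [e * c * m], so the squares
    add up to at most [e * c * m * S], and [c * m <= S] turns this into [e * S^2]. *)
Lemma sum_sqr_over_sqr_sum_cvg0 (R : realType) (g : nat -> R) (c : R) :
  (forall i, 0 <= g i) -> g i / i.+1%:R @[i --> \oo] --> (0 : R) -> 0 < c ->
  (\forall m \near \oo, c * m%:R <= \sum_(i < m) g i) ->
  (\sum_(i < m) g i ^+ 2) / (\sum_(i < m) g i) ^+ 2 @[m --> \oo] --> (0 : R).
Proof.
move=> g0 g_cvg c0 gc; apply/cvgrPdist_le => e e0.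
have ec0 : 0 < e * c by rewrite mulr_gt0.
have gm := near_le_scaled_index _ g _ g0 g_cvg ec0.
near=> m.
have S0 : 0 < \sum_(i < m) g i.
  apply: lt_le_trans (near gc m _); rewrite // mulr_gt0// ltr0n.
  by near: m; exists 1%N.
rewrite sub0r normrN ger0_norm ?divr_ge0 ?sqr_ge0 ?sumr_ge0//; last first.
  by move=> i _; exact: sqr_ge0.
rewrite ler_pdivrMr ?exprn_gt0//.
apply: (@le_trans _ _ (e * c * m%:R * \sum_(i < m) g i)).
  rewrite mulr_sumr; apply: ler_sum => i _.
  by rewrite expr2 ler_wpM2r//; apply: (near gm m).
by rewrite expr2 mulrA ler_pM2r// -mulrA ler_pM2l//; near: m.
Unshelve. all: by end_near. Qed.

(** * Finite inequalities and deterministic bounds on the costs *)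

Lemma sum_sqr_le_sqr_sum (R : realType) (I : finType) (y : I -> R) :
  (forall i, 0 <= y i) -> \sum_i y i ^+ 2 <= (\sum_i y i) ^+ 2.
Proof.
move=> y0; rewrite [leRHS]expr2 mulr_suml; apply: ler_sum => i _.
by rewrite expr2 ler_wpM2l// (bigD1 i)//= lerDl sumr_ge0.
Qed.

Lemma sqr_sum_le_weighted (R : realType) (I : finType) (w y : I -> R) :
  (forall i, 0 < w i) ->
  (\sum_i y i) ^+ 2 <= (\sum_i (w i)^-1) * \sum_i w i * y i ^+ 2.
Proof.
move=> w0; set S := \sum_i y i; set W := \sum_i (w i)^-1.
(* An empty index type would give [W = 0], by which the argument below divides. *)
have [i _|noI] := pickP (@predT I); last first.
  by rewrite /S /W !big_pred0// mul0r expr0n.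
have W0 : 0 < W.
  rewrite /W (bigD1 i)//= ltr_pwDl ?invr_gt0// sumr_ge0// => k _.
  by rewrite invr_ge0 ltW.
(* Sum of [w y^2 >= 2 s y - s^2 / w] for the best choice [s = S / W]. *)
rewrite mulrC -ler_pdivrMr//.
have -> : S ^+ 2 / W = \sum_i (2 * (S / W) * y i - (S / W) ^+ 2 * (w i)^-1).
  rewrite sumrB -!mulr_sumr -/S -/W; field; lra.
apply: ler_sum => {}i _; rewrite -subr_ge0.
have -> : w i * y i ^+ 2 - (2 * (S / W) * y i - (S / W) ^+ 2 / w i) =
    w i * (y i - S / W / w i) ^+ 2.
  by field; rewrite !gt_eqF.
by rewrite mulr_ge0 ?sqr_ge0// ltW.
Qed.

Section price_of_anarchy.
Context (R : realType) (h : nat) (p : 'I_h -> R) (p_gt0 : forall t, 0 < p t).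

Lemma aux_cost_ge0 m (x : 'M[R]_(m, h)) : 0 <= aux_cost p x.
Proof.
by apply: sumr_ge0 => i _; apply: sumr_ge0 => t _; rewrite mulr_ge0 ?sqr_ge0 ?ltW.
Qed.

Variables (a : nat -> agent R h) (m : nat) (x0 : 'I_h -> R) (x : 'M[R]_(m, h)).
Hypotheses (xlow_ge0 : forall i t, 0 <= xlow (a i) t) (x0_ge0 : forall t, 0 <= x0 t).
Hypothesis xa : joint_set a m x.

Let x_ge0 i t : 0 <= x i t.
Proof.
have [_ /(_ t)] := xa i; rewrite mxE in_itv/= => /andP[+ _].
exact: le_trans.
Qed.

Let row_sum i : \sum_t x i t = gamma (a i).
Proof. by have [<- _] := xa i; apply: eq_bigr => t _; rewrite mxE. Qed.

(** Each [p t] is at most the sum of all of them, and the squares of nonnegative entries add up to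
    at most the square of their row sum [gamma (a i)]. *)
Lemma aux_cost_le :
  aux_cost p x <= (\sum_t p t) * \sum_(i < m) gamma (a i) ^+ 2.
Proof.
rewrite mulr_sumr; apply: ler_sum => i _.
apply: (@le_trans _ _ ((\sum_t p t) * \sum_t x i t ^+ 2)).
  rewrite mulr_sumr; apply: ler_sum => t _; rewrite ler_wpM2r ?sqr_ge0//.
  by rewrite (bigD1 t)//= lerDl sumr_ge0// => s _; rewrite ltW.
rewrite ler_wpM2l ?sumr_ge0// => [t _|]; first by rewrite ltW.
by rewrite -row_sum sum_sqr_le_sqr_sum.
Qed.

(** Weighted Cauchy-Schwarz over the time slots, with weights [p]; the nonnegative [x0] only
    increases the slot totals, and without it they add up to the sum of the [gamma (a i)]. *)
Lemma social_cost_ge :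
  (\sum_(i < m) gamma (a i)) ^+ 2 <= (\sum_t (p t)^-1) * social_cost p x0 x.
Proof.
apply: le_trans (sqr_sum_le_weighted _ _ _ _ p_gt0).
have -> : \sum_(i < m) gamma (a i) = \sum_t \sum_(i < m) x i t.
  by rewrite exchange_big/=; apply: eq_bigr => i _; rewrite row_sum.
rewrite lerXn2r ?nnegrE ?sumr_ge0// => [t _|t _|].
- exact: sumr_ge0.
- by rewrite addr_ge0// sumr_ge0.
- by apply: ler_sum => t _; rewrite lerDl.
Qed.

End price_of_anarchy.

Lemma price_of_anarchy_bounds (R : realType) (h : nat) (p : 'I_h -> R)
    (a : nat -> agent R h) (m : nat) (x0 : 'I_h -> R) (xs xas : 'M[R]_(m, h)) :
  (forall t, 0 < p t) -> (forall i t, 0 <= xlow (a i) t) ->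
  (forall t, 0 <= x0 t) -> 0 < \sum_(i < m) gamma (a i) ->
  minimizer (joint_set a m) (social_cost p x0) xs ->
  minimizer (joint_set a m) (fun x => social_cost p x0 x + aux_cost p x) xas ->
  [/\ 0 < social_cost p x0 xs,
    1 <= social_cost p x0 xas / social_cost p x0 xs &
    social_cost p x0 xas / social_cost p x0 xs <=
      1 + (\sum_t p t) * (\sum_t (p t)^-1) *
        ((\sum_(i < m) gamma (a i) ^+ 2) / (\sum_(i < m) gamma (a i)) ^+ 2)].
Proof.
move=> p0 xl0 x00 S0 [xsa xs_min] [xasa xas_min].
have Fge := social_cost_ge _ _ _ p0 _ _ _ _ xl0 x00 xsa.
have S20 : 0 < (\sum_(i < m) gamma (a i)) ^+ 2 by rewrite exprn_gt0.
have W0 : 0 <= \sum_t (p t)^-1 by apply: sumr_ge0 => t _; rewrite invr_ge0 ltW.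
have WF0 := lt_le_trans S20 Fge.
(* Positivity is read off from the positive product with the nonnegative constant of the lower
   bound. *)
have F0 : 0 < social_cost p x0 xs.
  by rewrite ltNge; apply: contraTN WF0 => F0; rewrite -leNgt mulr_ge0_le0.
split=> //; first by rewrite ler_pdivlMr// mul1r; exact: xs_min.
have := xas_min _ xsa.
have := aux_cost_ge0 _ _ _ p0 _ xas.
have := aux_cost_le _ _ _ p0 _ _ _ xl0 xsa.
move=> AQ A0 FA.
set Pp := \sum_t p t in AQ *; set W := \sum_t (p t)^-1 in Fge *.
set Q := \sum_(i < m) gamma (a i) ^+ 2 in AQ *.
have PQ0 : 0 <= Pp * Q.
  by rewrite mulr_ge0// sumr_ge0// => i _; rewrite ?sqr_ge0 ?ltW.
rewrite ler_pdivrMr// mulrDl mul1r.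
(* The error term, multiplied by the optimal cost, is [Pp * Q] times a factor that the lower bound
   on that cost makes at least 1; it thus dominates the auxiliary cost of [xs]. *)
have -> : Pp * W * (Q / (\sum_(i < m) gamma (a i)) ^+ 2) * social_cost p x0 xs =
    Pp * Q * (W * social_cost p x0 xs / (\sum_(i < m) gamma (a i)) ^+ 2) by ring.
have : 1 <= W * social_cost p x0 xs / (\sum_(i < m) gamma (a i)) ^+ 2.
  by rewrite ler_pdivlMr// mul1r.
move=> /(ler_wpM2l PQ0); rewrite mulr1; lra.
Qed.

(** * Almost sure consequences of the i.i.d. assumption *)

Section iid_agents.
Context (R : realType) (d d' : measure_display) (Omega : measurableType d)
  (T : measurableType d') (P : probability Omega R) (X : nat -> {RV P >-> T}).

(** Carries sign conditions assumed for agent 0 to every agent: the complement of [B] has the same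
    probability under each law. *)
Lemma ae_identically_distributed (B : set T) i j :
  identically_distributed X -> measurable B ->
  {ae P, forall w, B (X i w)} -> {ae P, forall w, B (X j w)}.
Proof.
move=> Xid mB aeB; have mCB := measurableC mB.
have mXB k : measurable (X k @^-1` ~` B) by exact: measurable_funPTI.
apply/negligibleP; first exact: mXB.
apply: (eq_trans (esym (Xid i j _ mCB))).
exact: (proj1 (negligibleP _ (mXB i))).
Qed.

Lemma expectation_identically_distributed (f : T -> R) i j :
  identically_distributed X -> measurable_fun setT f -> (forall y, 0 <= f y) ->
  ('E_P[f \o X i] = 'E_P[f \o X j])%E.
Proof.
move=> Xid mf f0; rewrite unlock.
have mEf : measurable_fun setT (EFin \o f) by exact/measurable_EFinP.
rewrite -(ge0_integral_distribution (X i) mEf)//.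
rewrite -(ge0_integral_distribution (X j) mEf)//.
by apply: eq_measure_integral => B mB _; exact: Xid.
Qed.

Lemma mutually_independentI (B : set T) i j :
  mutually_independent X -> measurable B -> i != j ->
  P (X i @^-1` B `&` X j @^-1` B) = (P (X i @^-1` B) * P (X j @^-1` B))%E.
Proof.
move=> Xind mB ij; have := Xind [fset i; j]%fset (fun=> B) (fun _ _ => mB).
rewrite bigcap_fset big_fsetU1 ?inE// big_seq_fset1 => ->.
by rewrite big_fsetU1 ?inE// big_seq_fset1.
Qed.

End iid_agents.

(** The integral of [(X n / (n+1))^2] is at most [K / (n+1)^2], which is summable. *)
Lemma ae_over_index_cvg0 (R : realType) (d : measure_display)
    (T : measurableType d) (mu : {measure set T -> \bar R})
    (X : nat -> T -> R) (K : R) :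
  (forall n, measurable_fun setT (X n)) ->
  (forall n, (\int[mu]_x (X n x ^+ 2)%:E <= K%:E)%E) ->
  \forall x \ae mu, X n x / n.+1%:R @[n --> \oo] --> (0 : R).
Proof.
move=> mX XK.
have mX2 n : measurable_fun setT (fun x => (X n x ^+ 2)%:E).
  by apply/measurable_EFinP; exact: measurable_funX.
have K0 : 0 <= K.
  rewrite -lee_fin; apply: le_trans (XK 0%N).
  by apply: integral_ge0 => x _; rewrite lee_fin sqr_ge0.
have : \forall x \ae mu, (X n x / n.+1%:R) ^+ 2 @[n --> \oo] --> (0 : R).
  apply: ae_cvg0_of_summable_integral => [n|n x|].
  - by apply: measurable_funX; exact: measurable_funM.
  - exact: sqr_ge0.
  apply: (@le_lt_trans _ _ (\sum_(n <oo) (K%:E * (n.+1%:R ^- 2)%:E))%E).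
    apply: lee_nneseries => [n _ _|n _].
      by apply: integral_ge0 => x _; rewrite lee_fin sqr_ge0.
    under eq_integral do rewrite exprMn mulrC EFinM.
    rewrite ge0_integralZl_EFin ?sqr_ge0//; last first.
      by move=> x _; rewrite lee_fin sqr_ge0.
    by rewrite muleC exprVn lee_wpmul2r// lee_fin.
  rewrite nneseriesZl// lte_mul_pinfty ?lee_fin//.
  exact: nneseries_inv_sqr_lty.
apply: filterS => x /cvgrPdist_lt X_cvg; apply/cvgrPdist_lt => e e0.
have e20 : 0 < e ^+ 2 by rewrite exprn_gt0.
have := X_cvg _ e20; apply: filterS => n.
rewrite !sub0r !normrN normrX => lt2.
by rewrite ltNge; apply: contraTN lt2 => ?;
  rewrite -leNgt lerXn2r// nnegrE ltW.
Qed.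

Lemma measurable_superlevel (R : realType) (d : measure_display)
    (T : measurableType d) (g : T -> R) (c : R) :
  measurable_fun setT g -> measurable [set x | c < g x].
Proof.
move=> mg; rewrite -[X in measurable X]setTI.
have -> : [set x | c < g x] = g @^-1` `]c, +oo[%classic.
  by apply/seteqP; split => x /=; rewrite in_itv/= andbT.
exact: mg.
Qed.

(** Otherwise [g <= 1/(n+1)] would hold for all [n] almost surely, against [g > 0]. *)
Lemma ae_gt0_prob_level (R : realType) (d : measure_display)
    (T : measurableType d) (P : probability T R) (g : T -> R) :
  measurable_fun setT g -> {ae P, forall w, 0 < g w} ->
  exists2 c : R, 0 < c & (0 < P [set w | (c < g w)%R])%E.
Proof.
move=> mg g0; apply: contrapT => noc.
have mgc c : measurable [set w | c < g w] by exact: measurable_superlevel.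
have : {ae P, forall w, forall n, g w <= n.+1%:R^-1}.
  apply: ae_foralln => n; exists [set w | n.+1%:R^-1 < g w]; split => //.
    apply/eqP; rewrite eq_le measure_ge0 andbT leNgt; apply/negP => Pgt.
    by apply: noc; exists n.+1%:R^-1; rewrite ?invr_gt0.
  by move=> w /= /negP; rewrite ltNge.
have PT : (0 < P setT)%E by rewrite probability_setT.
move=> gle.
(* An almost sure event is nonempty because the whole space has positive mass; a single point yields
   the contradiction. *)
have := @filter_ex _ _ (ae_properfilter_algebraOfSetsType PT) _ (filterI g0 gle).
move=> [w [/= gw0 gwle]].
have := @cvg_harmonic R => /cvgrPdist_lt /(_ _ gw0) [n _ /(_ n (leqnn n))].
by rewrite /= sub0r normrN ger0_norm ?invr_ge0// ltNge gwle.
Qed.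

Lemma measurable_gamma (R : realType) (h : nat) :
  measurable_fun setT (gamma : agent R h -> R).
Proof. by apply: measurableT_comp; exact: measurable_fst. Qed.

Lemma measurable_xlow (R : realType) (h : nat) (t : 'I_h) :
  measurable_fun setT (fun a : agent R h => xlow a t).
Proof.
apply: (measurableT_comp (measurable_tnth t)).
by apply: measurableT_comp; [exact: measurable_snd|exact: measurable_fst].
Qed.

(** Every agent with [gamma > c] contributes at least [c] and the others at least 0, so the sum is
    at least [c] times the count of such agents. *)
Lemma ae_sum_gamma_ge (R : realType) (d : measure_display) (Omega : measurableType d)
    (P : probability Omega R) (h : nat) (theta : nat -> {RV P >-> agent R h}) :
  mutually_independent theta -> identically_distributed theta ->
  {ae P, forall w, forall i, 0 < gamma (theta i w)} ->
  exists2 c : R, 0 < c & {ae P, forall w, \forall m \near \oo,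
    c * m%:R <= \sum_(i < m) gamma (theta i w)}.
Proof.
move=> indep ident gamma_gt0.
have mgam i : measurable_fun setT (fun w => gamma (theta i w)).
  by apply: measurableT_comp => //; exact: measurable_gamma.
have [|c c0 Pc] := ae_gt0_prob_level _ _ _ P _ (mgam 0%N).
  by apply: filterS gamma_gt0 => w; exact.
pose B := [set a : agent R h | c < gamma a].
have mB : measurable B by apply: measurable_superlevel; exact: measurable_gamma.
pose A i := theta i @^-1` B.
have mA i : measurable (A i) by exact: measurable_funPTI.
pose q := fine (P (A 0%N)).
have PA i : P (A i) = q%:E.
  rewrite /q fineK; last exact: fin_num_measure.
  exact: ident.
have PAA i j : i != j -> P (A i `&` A j) = (q ^+ 2)%:E.
  by move=> ij; rewrite /A mutually_independentI// !PA.
have q0 : 0 < q by rewrite -lte_fin -(PA 0%N).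
exists (c * (q / 8)); first by rewrite !mulr_gt0// invr_gt0.
have := ae_indic_sum_ge _ _ _ _ _ _ mA PA PAA q0.
apply: filterS2 gamma_gt0 => w gamma_gt0; apply: filterS => m Nm.
rewrite -mulrA; apply: (@le_trans _ _ (c * \sum_(i < m) \1_(A i) w)).
  by rewrite ler_pM2l.
rewrite mulr_sumr; apply: ler_sum => i _.
rewrite indicE; case: (boolP (w \in A i)) => [|_]; last by rewrite mulr0 ltW.
by move=> /set_mem cg; rewrite mulr1 ltW.
Qed.

Theorem theorem2 (R : realType) (d : measure_display) (Omega : measurableType d)
    (P : probability Omega R) (h : nat) (p : 'I_h -> R)
    (theta : nat -> {RV P >-> agent R h})
    (x0 : nat -> 'I_h -> R) (x0hat : 'I_h -> R)
    (xstar xastar : forall m : nat, Omega -> 'M[R]_(m, h))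
    (h_ge1 : (1 <= h)%N)
    (p_gt0 : forall t, 0 < p t)
    (theta_indep : mutually_independent theta)
    (theta_ident : identically_distributed theta)
    (gamma_gt0 : {ae P, forall w, 0 < gamma (theta 0%N w)})
    (xlow_ge0 : {ae P, forall w, forall t, 0 <= xlow (theta 0%N w) t})
    (xup_ge0 : {ae P, forall w, forall t, 0 <= xup (theta 0%N w) t})
    (E_gamma : ('E_P[fun w => gamma (theta 0%N w)] < +oo)%E)
    (E_gamma2 : ('E_P[fun w => (gamma (theta 0%N w) ^+ 2)%R] < +oo)%E)
    (constraint_nonempty_compact : forall i, {ae P, forall w,
       constraint_set (theta i w) !=set0 /\ compact (constraint_set (theta i w))})
    (x0_ge0 : forall m t, (1 <= m)%N -> 0 <= x0 m t)
    (x0_lim : forall t, x0 m t / m%:R @[m --> \oo] --> x0hat t)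
    (xstar_min : forall m, (1 <= m)%N -> {ae P, forall w,
       minimizer (joint_set (fun i => theta i w) m)
                 (social_cost p (x0 m))
                 (xstar m w)})
    (xastar_min : forall m, (1 <= m)%N -> {ae P, forall w,
       minimizer (joint_set (fun i => theta i w) m)
                 (fun x => social_cost p (x0 m) x + aux_cost p x)
                 (xastar m w)}) :
  {ae P, forall w,
    (forall m, (1 <= m)%N -> 0 < social_cost p (x0 m) (xstar m w)) /\
    social_cost p (x0 m) (xastar m w) / social_cost p (x0 m) (xstar m w)
      @[m --> \oo] --> (1 : R)}.
Proof.
have mgam : measurable_fun setT (gamma : agent R h -> R) := measurable_gamma R h.
have gamma_gt0_all : {ae P, forall w, forall i, 0 < gamma (theta i w)}.
  have mB : measurable [set a : agent R h | 0 < gamma a].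
    exact: measurable_superlevel.
  apply: ae_foralln => i.
  exact: (ae_identically_distributed _ _ _ _ _ _ _ _ 0%N i theta_ident mB gamma_gt0).
have xlow_ge0_all : {ae P, forall w, forall i t, 0 <= xlow (theta i w) t}.
  apply: ae_foralln => i; apply: filter_forall => t.
  have mB : measurable [set a : agent R h | 0 <= xlow a t].
    rewrite -[X in measurable X]setTI.
    have -> : [set a : agent R h | 0 <= xlow a t] =
        (fun a => xlow a t) @^-1` `[0, +oo[%classic.
      by apply/seteqP; split => a /=; rewrite in_itv/= andbT.
    exact: measurable_xlow.
  apply: (ae_identically_distributed _ _ _ _ _ _ _ _ 0%N i theta_ident mB).
  by apply: filterS xlow_ge0 => w; exact.
have gamma_over_index : {ae P, forall w,
    gamma (theta i w) / i.+1%:R @[i --> \oo] --> (0 : R)}.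
  (* The common bound is the second moment of agent 0, finite by [E_gamma2] and equal to that of
     every agent. *)
  apply: (ae_over_index_cvg0 _ _ _ _ _
      (fine 'E_P[fun w => (gamma (theta 0%N w) ^+ 2)%R]%E)) => [i|i].
    exact: measurableT_comp.
  have E0 : (0 <= 'E_P[fun w => (gamma (theta 0%N w) ^+ 2)%R])%E.
    by apply: expectation_ge0 => w; exact: sqr_ge0.
  rewrite fineK ?ge0_fin_numE//.
  have := expectation_identically_distributed _ _ _ _ _ P theta
    (fun a => gamma a ^+ 2) 0%N i theta_ident (measurable_funX 2 mgam)
    (fun a => sqr_ge0 _).
  by rewrite /comp => ->; rewrite unlock.
have [c c0 sum_gamma] :=
  ae_sum_gamma_ge _ _ _ _ _ _ theta_indep theta_ident gamma_gt0_all.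
(* The exceptional null set may depend on [m]; the union over countably many [m] is still null. *)
have xstar_min_all : {ae P, forall w, forall m, (1 <= m)%N ->
    minimizer (joint_set (fun i => theta i w) m) (social_cost p (x0 m)) (xstar m w)}.
  apply: ae_foralln => -[|m]; first exact: aeW.
  by apply: filterS (xstar_min m.+1 isT) => w.
have xastar_min_all : {ae P, forall w, forall m, (1 <= m)%N ->
    minimizer (joint_set (fun i => theta i w) m)
      (fun x => social_cost p (x0 m) x + aux_cost p x) (xastar m w)}.
  apply: ae_foralln => -[|m]; first exact: aeW.
  by apply: filterS (xastar_min m.+1 isT) => w.
(* From here on the realization [w] is fixed and the argument is deterministic. *)
apply: filterS (filterI (filterI gamma_gt0_all xlow_ge0_all)
  (filterI (filterI gamma_over_index sum_gamma)
           (filterI xstar_min_all xastar_min_all))) => w.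
move=> [[gam0 xl0] [[gam_index sum_gam] [xs_min xas_min]]].
have sum_gt0 m : (1 <= m)%N -> 0 < \sum_(i < m) gamma (theta i w).
  case: m => // m _; rewrite big_ord_recl ltr_pwDl// sumr_ge0// => i _.
  exact: ltW.
have bounds m (m1 : (1 <= m)%N) := price_of_anarchy_bounds R h p
  (fun i => theta i w) m (x0 m) (xstar m w) (xastar m w) p_gt0 xl0
  (fun t => x0_ge0 m t m1) (sum_gt0 m m1) (xs_min m m1) (xas_min m m1).
split=> [m /bounds[]//|].
have ratio0 : (\sum_(i < m) gamma (theta i w) ^+ 2) /
    (\sum_(i < m) gamma (theta i w)) ^+ 2 @[m --> \oo] --> (0 : R).
  apply: (sum_sqr_over_sqr_sum_cvg0 _ (fun i => gamma (theta i w)) c) => // i.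
  exact: ltW.
have upper : 1 + (\sum_t p t) * (\sum_t (p t)^-1) *
    ((\sum_(i < m) gamma (theta i w) ^+ 2) /
     (\sum_(i < m) gamma (theta i w)) ^+ 2) @[m --> \oo] --> (1 : R).
  rewrite -[X in _ --> X]addr0; apply: cvgD; first exact: cvg_cst.
  rewrite -[X in _ --> X](mulr0 ((\sum_t p t) * (\sum_t (p t)^-1))).
  exact: (cvgM (cvg_cst _) ratio0).
apply: (squeeze_cvgr _ (cvg_cst (1 : R)) upper).
by exists 1%N => // m /= /bounds[_ -> ->].
Qed.
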